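(* Let $n\geq 3$ be an integer, and let $G$ be a triangle-free graph of order $n$ whose complement is connected. Then $$\rho(G)\leq \rho\left(K_{\lceil n/2\rceil,\lfloor n/2\rfloor}-e\right),$$ with equality if and only if $G\cong K_{\lceil n/2\rceil,\lfloor n/2\rfloor}-e$.
   Context: All graphs are finite, simple and undirected. $\rho(G)$ denotes the largest eigenvalue of the adjacency matrix of $G$. $K_{p,q}$ is the complete bipartite graph with part sizes $p$ and $q$, and $K_{p,q}-e$ is the graph obtained from it by deleting one edge (unique up to isomorphism). *)

(* Defs.v *)
From HB Require Import structures.
From mathcomp Require Import all_boot all_order all_algebra.
From mathcomp Require Import boolp classical_sets reals.
From mathcomp Require complex polyrcf.

Set Implicit Arguments.
Unset Strict Implicit.
Unset Printing Implicit Defensive.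

Import Order.TTheory GRing.Theory Num.Theory.
Local Open Scope ring_scope.

Record sgraph := SGraph {
  svertex :> finType;
  sedge : rel svertex;
  sedge_sym : symmetric sedge;
  sedge_irrefl : irreflexive sedge }.

Arguments sedge {s}.

Definition sg_iso (G H : sgraph) : Prop :=
  exists2 f : G -> H, bijective f & forall x y, sedge (f x) (f y) = sedge x y.

Definition triangle_free (G : sgraph) : Prop :=
  forall x y z : G, ~~ [&& sedge x y, sedge y z & sedge x z].

Definition sg_connected (G : sgraph) : Prop :=
  (0 < #|G|)%N /\ forall x y : G, connect sedge x y.

Definition compl_rel (G : sgraph) : rel G :=
  [rel x y | (x != y) && ~~ sedge x y].

Lemma compl_rel_sym (G : sgraph) : symmetric (@compl_rel G).
Proof. by move=> x y; rewrite /compl_rel /= eq_sym sedge_sym. Qed.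

Lemma compl_rel_irrefl (G : sgraph) : irreflexive (@compl_rel G).
Proof. by move=> x; rewrite /compl_rel /= eqxx. Qed.

Definition sg_compl (G : sgraph) : sgraph :=
  SGraph (@compl_rel_sym G) (@compl_rel_irrefl G).

Definition complete_bip_rel (p q : nat) : rel ('I_p + 'I_q)%type :=
  fun x y => match x, y with
             | inl _, inr _ | inr _, inl _ => true
             | _, _ => false
             end.

Lemma complete_bip_sym p q : symmetric (@complete_bip_rel p q).
Proof. by case=> ? []. Qed.

Lemma complete_bip_irrefl p q : irreflexive (@complete_bip_rel p q).
Proof. by case. Qed.

Definition complete_bip (p q : nat) : sgraph :=
  SGraph (@complete_bip_sym p q) (@complete_bip_irrefl p q).

Definition del_edge_rel (G : sgraph) (a b : G) : rel G :=
  [rel x y | sedge x y &&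
             ~~ (((x == a) && (y == b)) || ((x == b) && (y == a)))].

Lemma del_edge_sym (G : sgraph) (a b : G) : symmetric (del_edge_rel a b).
Proof.
move=> x y; rewrite /del_edge_rel /= sedge_sym orbC.
by rewrite (andbC (x == b)) (andbC (x == a)).
Qed.

Lemma del_edge_irrefl (G : sgraph) (a b : G) : irreflexive (del_edge_rel a b).
Proof. by move=> x; rewrite /del_edge_rel /= sedge_irrefl. Qed.

Definition del_edge (G : sgraph) (a b : G) : sgraph :=
  SGraph (del_edge_sym a b) (del_edge_irrefl a b).

Definition adjacency_mx (R : realType) (G : sgraph) : 'M[R]_#|G| :=
  \matrix_(i, j) (sedge (enum_val i) (enum_val j))%:R.

Definition largest_eigenvalue (R : realType) (n : nat) (A : 'M[R]_n) (r : R) :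
  Prop := eigenvalue A r /\ forall s : R, eigenvalue A s -> s <= r.

(* The default value 0 is only reached on the graph with no vertices (rhoP). *)
Definition rho (R : realType) (G : sgraph) : R :=
  xget 0 [set r | largest_eigenvalue (adjacency_mx R G) r]%classic.

Section SymmetricEigenvalue.
Import complex polyrcf.
Local Open Scope complex_scope.

Lemma sym_eigenvalue_ex (R : realType) (n : nat) (A : 'M[R]_n) :
  (0 < n)%N -> A^T = A -> exists r, eigenvalue A r.
Proof.
move=> n0 symA; pose B := map_mx (real_complex R) A.
have /closed_rootP[z] : size (char_poly B) != 1%N.
  by rewrite size_char_poly eqSS -lt0n.
rewrite -eigenvalue_root_char => ez.
suff zr : z^*%C = z.
  exists (complex.Re z); rewrite eigenvalue_root_char.
  move: ez; rewrite eigenvalue_root_char -map_char_poly.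
  have -> : z = (complex.Re z)%:C.
    case: z zr => a b [] /eqP; rewrite eq_sym -addr_eq0 -mulr2n mulrn_eq0 /=.
    by move=> /eqP ->.
  by rewrite fmorph_root.
have /eigenvalueP[v vB v0] := ez.
pose w := (map_mx conjc v)^T.
pose S := (v *m w) 0 0.
have SE : S = \sum_j v 0 j * (v 0 j)^*%C.
  by rewrite /S mxE; apply: eq_bigr => j _; rewrite !mxE.
have S0 : S != 0.
  apply/eqP; rewrite SE => /eqP; rewrite psumr_eq0; last first.
    by move=> j _; rewrite -sqr_normc exprn_ge0.
  move=> /allP h; move/eqP: v0; apply; apply/rowP => j; rewrite mxE.
  have /implyP := h j (mem_index_enum j).
  by move=> /(_ isT); rewrite -sqr_normc expf_eq0 normr_eq0 => /eqP.
have q1 : v *m B *m w = z *: (v *m w) by rewrite vB scalemxAl.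
have Sc : S^*%C = S.
  rewrite SE rmorph_sum; apply: eq_bigr => j _.
  by rewrite rmorphM /= conjcK mulrC.
have Bc : map_mx conjc B = B.
  by apply/matrixP => i j; rewrite !mxE conjc_real.
have BT : B^T = B by rewrite /B map_trmx symA.
have q2 : map_mx conjc (v *m B *m w)^T = v *m B *m w.
  rewrite !trmx_mul !map_mxM /= BT Bc /w trmxK map_trmx mulmxA.
  congr (_ *m _ *m _); apply/matrixP => i j; rewrite !mxE; exact: conjcK.
move: q2; rewrite q1 => /matrixP/(_ 0 0).
rewrite mxE mxE [LHS]/= [in LHS]mxE [RHS]mxE -/S rmorphM /= Sc.
exact: mulIf.
Qed.

Lemma largest_eigenvalue_ex (R : realType) (n : nat) (A : 'M[R]_n) :
  (0 < n)%N -> A^T = A -> exists r, largest_eigenvalue A r.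
Proof.
move=> n0 symA; have [r0 er0] := sym_eigenvalue_ex n0 symA.
have p0 : char_poly A != 0 by rewrite -size_poly_eq0 size_char_poly.
pose s := rootsR (char_poly A).
have sP x : (x \in s) = eigenvalue A x.
  rewrite eigenvalue_root_char.
  by have := roots_on_rootsR p0 x; rewrite in_itv /= => ->.
pose m := \big[Num.max/r0]_(x <- s) x.
exists m; split; last by move=> x; rewrite -sP => xs; exact: le_bigmax_seq.
rewrite /m big_seq; elim/big_ind: _ => // [x y ex ey|x].
  by rewrite /Num.max; case: ifP.
by rewrite sP.
Qed.
End SymmetricEigenvalue.

Lemma rhoP (R : realType) (G : sgraph) :
  (0 < #|G|)%N -> largest_eigenvalue (adjacency_mx R G) (rho R G).
Proof.
move=> G0.
suff [r rP] : exists r, largest_eigenvalue (adjacency_mx R G) r.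
  exact: (@xgetPex _ 0 [set r | largest_eigenvalue (adjacency_mx R G) r]%classic
    (ex_intro _ r rP)).
apply: largest_eigenvalue_ex => //.
by apply/matrixP => i j; rewrite !mxE sedge_sym.
Qed.

(* Main.v *)
(** Let [x] be an eigenvector for the largest eigenvalue and [u] a vertex where
    [|x u|] is maximal. Evaluating [A^2 x] at [u] gives
    [rho^2 <= D], the sum of the degrees of the neighbours of [u]. The set
    [N] of these neighbours is independent, so [D] counts the edges between [N]
    and its complement [W]. With [d = |N|] and [m = ceil(n/2) floor(n/2)]: if
    [W] contains an edge, its ends have disjoint neighbourhoods in [N], so
    [D <= d (n - d - 1) <= m - 2]; otherwise [G] is bipartite with parts [N]
    and [W], and it misses an edge between them because its complement is
    connected, so that [D <= m - 2] unless [G] is the balanced complete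
    bipartite graph minus one edge. That graph has an explicit eigenvector
    whose eigenvalue has a square exceeding [m - 2]. *)

Require Import Defs.
From mathcomp Require Import all_boot all_order all_algebra.
From mathcomp Require Import reals.
From mathcomp Require Import zify ring lra.

Set Implicit Arguments.
Unset Strict Implicit.

Import Order.TTheory GRing.Theory Num.Theory.
Local Open Scope ring_scope.

(** * Eigenvectors as weightings of the vertices *)

Lemma adjacency_eigenvalueP (R : realType) (G : sgraph) (r : R) :
  eigenvalue (adjacency_mx R G) r <->
  exists2 x : G -> R, exists u, x u != 0 &
    forall u, \sum_(v | sedge u v) x v = r * x u.
Proof.
split=> [/eigenvalueP[z zA z0]|[x [u xu] xA]].
  exists (fun v => z 0 (enum_rank v)).
    have /rV0Pn[i zi] := z0.
    by exists (enum_val i); rewrite enum_valK.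
  move=> u; move/rowP/(_ (enum_rank u)): zA; rewrite !mxE => <-.
  rewrite big_mkcond (reindex_onto enum_rank enum_val) => [|i _]; last first.
    exact: enum_valK.
  apply: eq_big => [v|v _]; first by rewrite enum_rankK eqxx.
  by rewrite mxE !enum_rankK sedge_sym; case: ifP; rewrite ?mulr1 ?mulr0.
apply/eigenvalueP; exists (\row_i x (enum_val i)).
  apply/rowP => i; rewrite !mxE -xA [RHS]big_mkcond.
  rewrite [RHS](reindex_onto enum_val enum_rank) => [|v _]; last first.
    exact: enum_rankK.
  apply: eq_big => [j|j _]; first by rewrite enum_valK eqxx.
  by rewrite !mxE sedge_sym; case: ifP; rewrite ?mulr1 ?mulr0.
apply/rV0Pn; exists (enum_rank u); by rewrite mxE enum_rankK.
Qed.

Lemma sg_iso_sym (G H : sgraph) : sg_iso G H -> sg_iso H G.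
Proof.
move=> [f [g fK gK] fE]; exists g; first by exists f.
by move=> x y; rewrite -fE !gK.
Qed.

Lemma sg_iso_eigenvalue (R : realType) (G H : sgraph) (r : R) :
  sg_iso G H -> eigenvalue (adjacency_mx R H) r ->
  eigenvalue (adjacency_mx R G) r.
Proof.
move=> [f [g fK gK] fE] /adjacency_eigenvalueP[x [u xu] xA].
apply/adjacency_eigenvalueP; exists (x \o f).
  by exists (g u); rewrite /= gK.
move=> v; rewrite /= -xA [RHS](reindex f) /=; last by exists g => ? _.
by apply: eq_bigl => y; rewrite fE.
Qed.

Lemma sg_iso_rho (R : realType) (G H : sgraph) :
  (0 < #|G|)%N -> (0 < #|H|)%N -> sg_iso G H -> rho R G = rho R H.
Proof.
move=> G0 H0 iGH; have [eG leG] := rhoP R G0; have [eH leH] := rhoP R H0.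
apply/le_anti/andP; split.
  exact: leH (sg_iso_eigenvalue (sg_iso_sym iGH) eG).
exact: leG (sg_iso_eigenvalue iGH eH).
Qed.

(** Absolute values stand in for the positivity of a Perron vector, so the bound holds for every
    eigenvalue. *)
Lemma eigenvalue_sqr_le (R : realType) (G : sgraph) (r : R) :
  eigenvalue (adjacency_mx R G) r ->
  exists u : G, r ^+ 2 <= (\sum_(v | sedge u v) #|[set w | sedge v w]|)%:R.
Proof.
move=> /adjacency_eigenvalueP[x [u0 xu0] xA].
pose u := [arg max_(v > u0) `|x v|]%O.
have umax v : `|x v| <= `|x u|.
  by rewrite /u; case: Order.TotalTheory.arg_maxP => // i _; apply.
have xu : 0 < `|x u| by apply: lt_le_trans (umax u0); rewrite normr_gt0.
exists u; rewrite -(ler_pM2r xu) natr_sum mulr_suml.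
have -> : r ^+ 2 * `|x u| = `|\sum_(v | sedge u v) \sum_(w | sedge v w) x w|.
  rewrite (eq_bigr (fun v => r * x v)) => [|v _]; last exact: xA.
  by rewrite -mulr_sumr xA mulrA -expr2 normrM ger0_norm // sqr_ge0.
apply: le_trans (ler_norm_sum _ _ _) _; apply: ler_sum => v _.
apply: le_trans (ler_norm_sum _ _ _) _.
apply: le_trans (ler_sum _ (fun w _ => umax w)) _.
by rewrite sumr_const mulr_natl cardsE.
Qed.

(** * Complete bipartite graphs minus an edge, recognised inside a given graph *)

Definition bip_minus_edge (G : sgraph) (S : {set G}) (v w : G) : Prop :=
  [/\ v \in S, w \notin S & forall x y, sedge x y =
    ((x \in S) != (y \in S)) &&
    ~~ (((x == v) && (y == w)) || ((x == w) && (y == v)))].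

Lemma bip_minus_edgeC (G : sgraph) (S : {set G}) (v w : G) :
  bip_minus_edge S v w -> bip_minus_edge (~: S) w v.
Proof.
move=> [vS wS E]; split; rewrite ?inE ?negbK // => x y.
by rewrite E !inE orbC; congr (_ && _); case: (x \in S); case: (y \in S).
Qed.

Lemma del_edge_bip (p q : nat) (a b : complete_bip p q) : sedge a b ->
  exists (S : {set del_edge a b}) v w, bip_minus_edge S v w /\ #|S| = p.
Proof.
move=> ab.
pose isl (x : 'I_p + 'I_q) := if x is inl _ then true else false.
have [S [cS SE]] : exists S : {set del_edge a b}, #|S| = p /\ S =i isl.
  exists [set x | isl x]; split; last by move=> x; rewrite inE.
  have -> : [set x | isl x] = [set inl i | i in [set: 'I_p]].
    apply/setP => -[i|j]; rewrite !inE; apply/esym.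
      by apply/imsetP; exists i.
    by apply/negbTE/imsetP => -[].
  by rewrite card_imset ?cardsT ?card_ord // => i j [].
(* The deleted edge may be given in either orientation; [v] is its end in the left part. *)
exists S; case: a b ab S cS SE => [i|j] [i'|j'] //= _ S cS SE.
  exists (inl i), (inr j'); split=> //; split; rewrite ?SE //.
  by move=> [x|x] [y|y]; rewrite !SE.
exists (inl i'), (inr j); split=> //; split; rewrite ?SE //.
by move=> [x|x] [y|y]; rewrite !SE /= /del_edge_rel /= // orbC.
Qed.

Section BipEnum.
Variables (G : sgraph) (S : {set G}) (v w : G).
Hypothesis bG : bip_minus_edge S v w.

(** The order is chosen so that [v] has position 0 and [w] position [#|S|]: adjacency can then be
    read off from positions. *)
Definition bip_enum : seq G :=
  (v :: enum (S :\ v)) ++ (w :: enum (~: S :\ w)).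

Let vS : v \in S. Proof. by case: bG. Qed.
Let wS : w \notin S. Proof. by case: bG. Qed.

Lemma size_bip_left : size (v :: enum (S :\ v)) = #|S|.
Proof. by rewrite /= -cardE (cardsD1 v S) vS. Qed.

Lemma mem_bip_left x : (x \in v :: enum (S :\ v)) = (x \in S).
Proof. by rewrite inE mem_enum !inE; case: eqP => // ->; rewrite vS. Qed.

Lemma mem_bip_right x : (x \in w :: enum (~: S :\ w)) = (x \notin S).
Proof. by rewrite inE mem_enum !inE; case: eqP => // ->; rewrite wS. Qed.

Lemma mem_bip_enum x : x \in bip_enum.
Proof. by rewrite mem_cat mem_bip_left mem_bip_right; case: (x \in S). Qed.

Lemma uniq_bip_enum : uniq bip_enum.
Proof.
have uniq_enum A (y : G) : uniq (y :: enum (A :\ y)).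
  by rewrite /= mem_enum enum_uniq !inE eqxx.
rewrite cat_uniq !uniq_enum andbT; apply/hasPn => x.
by rewrite mem_bip_right; apply: contra; rewrite mem_bip_left.
Qed.

Lemma size_bip_enum : size bip_enum = #|G|.
Proof.
rewrite -(card_uniqP uniq_bip_enum); apply: eq_card => x.
by rewrite mem_bip_enum.
Qed.

Lemma index_bip_enum x :
  [/\ (x \in S) = (index x bip_enum < #|S|)%N,
      (x == v) = (index x bip_enum == 0%N) &
      (x == w) = (index x bip_enum == #|S|)].
Proof.
have iE := index_cat x (v :: enum (S :\ v)) (w :: enum (~: S :\ w)).
split; first 2 last.
- rewrite /bip_enum iE mem_bip_left.
  case: ifP => xS.
    have := index_mem x (v :: enum (S :\ v)); rewrite mem_bip_left xS.
    rewrite size_bip_left => h; rewrite ltn_eqF //.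
    by apply: contraNF wS => /eqP <-.
  rewrite size_bip_left -[X in _ = (_ == X)]addn0 eqn_add2l /= eq_sym.
  by case: eqP.
- rewrite /bip_enum iE mem_bip_left size_bip_left; case: ifP => xS.
    by rewrite -mem_bip_left -index_mem size_bip_left in xS.
  by rewrite ltnNge leq_addr.
- by rewrite /bip_enum /= eq_sym; case: eqP.
Qed.

End BipEnum.

(** The isomorphism matches vertices with the same position in the two enumerations. *)
Lemma bip_minus_edge_iso (G H : sgraph) (S : {set G}) (T : {set H}) v w v' w' :
  bip_minus_edge S v w -> bip_minus_edge T v' w' ->
  #|S| = #|T| -> #|G| = #|H| -> sg_iso G H.
Proof.
move=> bG bH cST cGH.
pose f x := nth v' (bip_enum T v' w') (index x (bip_enum S v w)).
pose g y := nth v (bip_enum S v w) (index y (bip_enum T v' w')).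
have lt1 x : (index x (bip_enum S v w) < size (bip_enum T v' w'))%N.
  rewrite (size_bip_enum bH) -cGH -(size_bip_enum bG).
  by rewrite index_mem (mem_bip_enum bG).
have lt2 y : (index y (bip_enum T v' w') < size (bip_enum S v w))%N.
  rewrite (size_bip_enum bG) cGH -(size_bip_enum bH).
  by rewrite index_mem (mem_bip_enum bH).
have If x : index (f x) (bip_enum T v' w') = index x (bip_enum S v w).
  by rewrite index_uniq // (uniq_bip_enum bH).
have Ig y : index (g y) (bip_enum S v w) = index y (bip_enum T v' w').
  by rewrite index_uniq // (uniq_bip_enum bG).
exists f.
  exists g => x.
    by rewrite /g If nth_index // (mem_bip_enum bG).
  by rewrite /f Ig nth_index // (mem_bip_enum bH).
move=> x y; have [_ _ ->] := bG; have [_ _ ->] := bH.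
have [-> -> ->] := index_bip_enum bG x.
have [-> -> ->] := index_bip_enum bG y.
have [-> -> ->] := index_bip_enum bH (f x).
have [-> -> ->] := index_bip_enum bH (f y).
by rewrite !If cST.
Qed.

(* The quadratic in [r ^+ 2] is the nontrivial factor of the characteristic
   polynomial of [K_{p,q} - e]. *)
Lemma bip_minus_edge_eigenvalue (R : realType) (G : sgraph) (S : {set G})
    (v w : G) (p q : nat) (r : R) :
  bip_minus_edge S v w -> #|S| = p -> #|~: S| = q -> (1 < p)%N -> r != 0 ->
  (r ^+ 2) ^+ 2 + (p%:R - 1) * (q%:R - 1) = (p%:R * q%:R - 1) * r ^+ 2 ->
  eigenvalue (adjacency_mx R G) r.
Proof.
move=> [vS wS E] cS cT p1 r0 rE; apply/adjacency_eigenvalueP.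
pose t := r ^+ 2.
(* A weighting constant on the classes [{v}], [S :\ v], [{w}] and the rest. The values are chosen to
   make the equations at vertices outside [S] identities in [r]; those at vertices of [S] both
   reduce to [rE]. *)
pose x y := if y \in S then (if y == v then r * (t - p%:R + 1) else r * t)
            else (if y == w then (p%:R - 1) * t else p%:R * t - p%:R + 1).
have vw : v != w by apply: contraNneq wS => <-.
have sumS : \sum_(y in S | y != v) x y = (p%:R - 1) * (r * t).
  rewrite (eq_bigr (fun=> r * t)) => [|y /andP[yS yv]]; last first.
    by rewrite /x yS (negbTE yv).
  rewrite sumr_const -[LHS]mulr_natl -cS; congr (_ * _).
  rewrite (cardsD1 v S) vS natrD addrAC subrr add0r.
  by congr (_ %:R); apply: eq_card => y; rewrite !inE andbC.
have sumT : \sum_(y | (y \notin S) && (y != w)) x y =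
    (q%:R - 1) * (p%:R * t - p%:R + 1).
  rewrite (eq_bigr (fun=> p%:R * t - p%:R + 1)) => [|y /andP[yS yv]]; last first.
    by rewrite /x (negbTE yS) (negbTE yv).
  rewrite sumr_const -[LHS]mulr_natl -cT; congr (_ * _).
  rewrite (cardsD1 w (~: S)) inE wS natrD addrAC subrr add0r.
  by congr (_ %:R); apply: eq_card => y; rewrite !inE andbC.
exists x.
  exists w; rewrite /x (negbTE wS) eqxx mulf_neq0 ?expf_neq0 //.
  by rewrite subr_eq0 pnatr_eq1 gtn_eqF.
move=> u; case: (boolP (u \in S)) => uS.
  have uw : u != w by apply: contraNneq wS => <-.
  case: (eqVneq u v) => uv.
    rewrite (eq_bigl (fun y => (y \notin S) && (y != w))) => [|y]; last first.
      rewrite E uS uv eqxx (negbTE vw) /= orbF.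
      by case: (y \in S).
    rewrite sumT /x uS uv eqxx; move: rE; rewrite -/t => rE.
    by rewrite mulrA -expr2 -/t; lra.
  rewrite (eq_bigl (fun y => y \notin S)) => [|y]; last first.
    by rewrite E uS (negbTE uv) (negbTE uw) /= andbT; case: (y \in S).
  rewrite (bigD1 w) //= sumT /x uS (negbTE wS) eqxx (negbTE uv).
  by rewrite mulrA -expr2 -/t; move: rE; rewrite -/t => rE; lra.
have uv : u != v by apply: contraNneq uS => ->.
case: (eqVneq u w) => uw.
  rewrite (eq_bigl (fun y => (y \in S) && (y != v))) => [|y]; last first.
    by rewrite E (negbTE uS) uw eqxx [w == v]eq_sym (negbTE vw) /=; case: (y \in S).
  by rewrite sumS /x (negbTE uS) uw eqxx; ring.
rewrite (eq_bigl (fun y => y \in S)) => [|y]; last first.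
  by rewrite E (negbTE uS) (negbTE uv) (negbTE uw) /= andbT; case: (y \in S).
by rewrite (bigD1 v) //= sumS /x (negbTE uS) vS eqxx (negbTE uw); ring.
Qed.

(** * Products of two numbers with a given sum *)

Lemma uphalf_half_mul (n d : nat) : (d <= n)%N ->
  (d * (n - d) <= uphalf n * n./2)%N /\
  ((d * (n - d) = uphalf n * n./2)%N -> d = uphalf n \/ n - d = uphalf n)%N.
Proof.
move=> dn; have := leq_b1 (odd n).
have := odd_double_half n; have := uphalf_half n.
move: (n./2) (uphalf n) (nat_of_bool (odd n)) => h k b -> hn b1.
(* If [i] is the amount by which the smaller of [d] and [n - d] falls short of [h], the balanced
   product is larger by [i * (i + b)], which vanishes only for [i = 0]. *)
have [dh|dh] := leqP d h.
  have [i hE] : exists i, (h = d + i)%N by exists (h - d)%N; lia.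
  have eE : (n - d = d + b + i + i)%N by lia.
  by rewrite eE hE; split; nia.
have [j nE] : exists j, (n = d + j)%N by exists (n - d)%N; lia.
have jE : (n - d = j)%N by lia.
have [i hE] : exists i, (h = j + i)%N by exists (h - j)%N; lia.
have dE : (d = j + b + i + i)%N by lia.
by rewrite jE dE hE; split; nia.
Qed.

(** The left product is at most the balanced product for [n - 1], and passing from [n - 1] to [n]
    raises the latter by [n./2], which is at least 2 from [n = 4] on. *)
Lemma uphalf_half_mul_gap (n d : nat) : (d + 3 <= n)%N ->
  (d * (n - d).-1 + 2 <= uphalf n * n./2)%N.
Proof.
move=> dn; have d1n : (d <= n.-1)%N by lia.
have [+ _] := uphalf_half_mul d1n.
have -> : (n - d).-1 = (n.-1 - d)%N by lia.
have [h [nE|nE]] : exists h, n = h.*2.+2 \/ n = h.*2.+3.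
  by exists (n./2).-1; have := odd_double_half n; lia.
- have [-> -> -> ->] : [/\ uphalf n = h.+1, n./2 = h.+1,
    uphalf n.-1 = h.+1 & n.-1./2 = h] by split; lia.
  nia.
have [-> -> -> ->] : [/\ uphalf n = h.+2, n./2 = h.+1,
  uphalf n.-1 = h.+1 & n.-1./2 = h.+1] by split; lia.
(* For [h = 0], that is [n = 3], the gain is only 1, but [d = 0]. *)
by case: (posnP h); nia.
Qed.

(** * The degree sum over a neighbourhood *)

Lemma triangle_free_degree_sum (n : nat) (G : sgraph) (u : G) :
  (3 <= n)%N -> #|G| = n -> triangle_free G -> sg_connected (sg_compl G) ->
  (\sum_(v | sedge u v) #|[set w | sedge v w]| + 2 <= uphalf n * n./2)%N \/
  exists (S : {set G}) v w, bip_minus_edge S v w /\ #|S| = uphalf n.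
Proof.
move=> n3 cG tf [_ conG]; pose N (x : G) : {set G} := [set y | sedge x y].
set D := (\sum_(v | _) _)%N; pose W := ~: N u; pose d := #|N u|.
have inN x y : (y \in N x) = sedge x y by rewrite inE.
have inW y : (y \in W) = ~~ sedge u y by rewrite !inE.
have uW : u \in W by rewrite inW sedge_irrefl.
have cW : #|W| = (n - d)%N by rewrite cardsCs setCK cG.
have dn : (d <= n)%N by rewrite -cG max_card.
have NW v : sedge u v -> N v \subset W.
  move=> uv; apply/subsetP => y; rewrite inN inW => vy.
  by have := tf u v y; rewrite uv vy.
have sumN c : (\sum_(v | sedge u v) c = d * c)%N.
  by rewrite sum_nat_const; congr (_ * _)%N; apply: eq_card => v; rewrite inE.
case: (pickP (fun p : G * G => [&& p.1 \in W, p.2 \in W & sedge p.1 p.2])).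
  move=> [w1 w2] /= /and3P[w1W w2W w12]; left.
  (* [u] has no neighbour in [W], so [u], [w1], [w2] are three distinct elements of [W]. *)
  have d3 : (d + 3 <= n)%N.
    have : (#|[set u; w1; w2]| <= #|W|)%N.
      apply/subset_leq_card/subsetP => y.
      by rewrite !in_setU !in_set1 => /orP[/orP[]|] /eqP ->.
    have uw1 : u != w1 by apply: contraTneq w2W; rewrite inW => ->; rewrite w12.
    have uw2 : u != w2.
      by apply: contraTneq w1W; rewrite inW => ->; rewrite sedge_sym w12.
    have w1w2 : w1 != w2.
      by apply: contraTneq w12 => ->; rewrite sedge_irrefl.
    rewrite -setUA cardsU1 !inE negb_or uw1 uw2 cards2 w1w2 cW; lia.
  apply: leq_trans (uphalf_half_mul_gap d3); rewrite leq_add2r -sumN.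
  apply: leq_sum => v uv; rewrite -cW -ltnS prednK; last first.
    by rewrite (cardD1 u) uW.
  (* A neighbour [v] of [u] cannot be adjacent to both [w1] and [w2], so it misses a vertex of
     [W]. *)
  apply: proper_card; rewrite properE NW //=; apply/negP => /subsetP sWN.
  have vw1 := sWN _ w1W; have vw2 := sWN _ w2W; rewrite !inN in vw1 vw2.
  by have := tf v w1 w2; rewrite vw1 w12 vw2.
move=> noW.
have [d_max d_eq] := uphalf_half_mul dn.
(* The second sum counts the non-adjacent pairs between [N u] and [W]. *)
have Dc : (D + \sum_(v | sedge u v) #|W :\: N v| = d * (n - d))%N.
  rewrite -big_split -sumN; apply: eq_bigr => v uv /=.
  by rewrite -cW -(cardsID (N v) W) (setIidPr (NW v uv)).
case: (pickP (fun p : G * G => [&& sedge u p.1, p.2 \in W & ~~ sedge p.1 p.2])).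
  move=> [v w] /= /and3P[uv wW vw].
  have wD : w \in W :\: N v by rewrite in_setD inN vw wW.
  move: Dc; rewrite (bigD1 v) //= (cardsD1 w) wD => Dc.
  (* Besides the pair [(v, w)], [c1] counts the missing pairs at [v] and [c2] those at the other
     vertices of [N u]. If [D] is at least the balanced product minus 1, both are 0 and
     [d * (n - d)] is the balanced product. *)
  set c1 := #|_| in Dc; set c2 := (\sum_(_ | _) _)%N in Dc.
  have [D2|D2] := leqP (D + 2) (uphalf n * n./2); [by left|right].
  have c10 : c1 = 0%N by lia.
  have c20 : c2 = 0%N by lia.
  have dm : (d * (n - d) = uphalf n * n./2)%N by lia.
  have wN : w \notin N u by move: wW; rewrite inW inN.
  have bG : bip_minus_edge (N u) v w.
    have key x y : sedge u x -> y \in W ->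
        sedge x y = ~~ ((x == v) && (y == w)).
      move=> ux yW; have [->|xv] := eqVneq x v.
        have [->|yw] /= := eqVneq y w; first exact: negbTE.
        have /setP/(_ y) := cards0_eq c10.
        by rewrite in_setD1 yw in_setD yW andbT inN in_set0 => /negbFE.
      have xc : sedge u x && (x != v) by rewrite ux.
      move/eqP: c20; rewrite sum_nat_eq0 => /forallP/(_ x)/implyP/(_ xc).
      rewrite cards_eq0 => /eqP/setP/(_ y).
      by rewrite in_setD yW andbT inN in_set0 => /negbFE.
    split=> // [|x y]; rewrite !inN //.
    have [ux|ux] := boolP (sedge u x); have [uy|uy] := boolP (sedge u y) => /=.
    - by have := tf u x y; rewrite ux uy andbT /= => /negbTE.
    - rewrite (key x y) ?inW //.
      suff /negbTE -> : x != w by rewrite orbF.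
      by apply: contraTneq ux => ->; rewrite -inN.
    - rewrite sedge_sym (key y x) ?inW //.
      suff /negbTE -> : y != w by rewrite andbF andbC.
      by apply: contraTneq uy => ->; rewrite -inN.
    - by have := noW (x, y); rewrite /= !inW ux uy.
  (* The larger part is either [N u] or [W]; in the second case the sides are swapped. *)
  have [dE|dE] := d_eq dm; first by exists (N u), v, w.
  exists (~: N u), w, v; split; first exact: bip_minus_edgeC.
  by rewrite -/W cW.
move=> full; left.
(* For an isolated [u] there is no pair to miss, but then [D = 0]. *)
have [d0|/set0Pn[v]] := eqVneq (N u) set0.
  rewrite /D big_pred0 => [|v]; last by rewrite -inN d0 inE.
  by have := @uphalf_half_mul_gap n 0; rewrite mul0n => -> //.
rewrite inN => uv.
have cross x y : sedge u x -> ~~ sedge u y -> sedge x y.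
  move=> ux uy; have := full (x, y).
  by rewrite /= inW ux uy => /negbT; rewrite negbK.
(* No edge of the complement leaves [N u], which contains [v] but not [u]: this contradicts its
   connectedness. *)
have cl : closed (@sedge (sg_compl G)) (mem (N u)).
  move=> x y; rewrite /= /compl_rel /= => /andP[_ xy]; rewrite !inN.
  have [ux|ux] := boolP (sedge u x); have [uy|uy] := boolP (sedge u y) => //.
    by rewrite cross in xy.
  by rewrite sedge_sym cross in xy.
have := closed_connect cl (conG u v).
by rewrite /= !inN uv sedge_irrefl.
Qed.

(** * A strict lower bound for the extremal graph *)

Lemma bip_minus_edge_rho (R : realType) (n : nat) (G : sgraph) (S : {set G})
    (v w : G) :
  (3 <= n)%N -> #|G| = n -> bip_minus_edge S v w -> #|S| = uphalf n ->
  0 < rho R G /\ (uphalf n * n./2)%:R - 2 < rho R G ^+ 2.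
Proof.
move=> n3 cG bG cS.
have hn := odd_double_half n; have kn := uphalf_half n.
have cT : #|~: S| = n./2 by rewrite cardsCs setCK cG cS; lia.
have [_ le_rho] : largest_eigenvalue (adjacency_mx R G) (rho R G).
  by apply: rhoP; rewrite cG; lia.
set h := n./2 in hn kn cT *; set k := uphalf n in kn cS *.
have k2 : (1 < k)%N by lia.
have h1 : (0 < h)%N by lia.
have hkn : (h + k = n)%N by lia.
pose p : R := k%:R; pose q : R := h%:R; pose m := p * q.
have p2 : 2 <= p by rewrite ler_nat.
have q1 : 1 <= q by rewrite ler1n.
have pq3 : 3 <= p + q by rewrite -natrD ler_nat; lia.
have m2 : 2 <= m by rewrite /m; nra.
(* The discriminant of the quadratic in [r ^+ 2]. Its larger root, [t] below, exceeds [m - 2]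
   exactly when [s] exceeds [m - 3], and [disc - (m - 3) ^+ 2 = 4 * (p + q - 3)]. *)
pose disc := (m - 1) ^+ 2 - 4 * ((p - 1) * (q - 1)).
pose s := Num.sqrt disc.
have disc_gt : (m - 3) ^+ 2 <= disc.
  by rewrite /disc /m; nra.
have disc0 : 0 <= disc by apply: le_trans disc_gt; exact: sqr_ge0.
have sE : s ^+ 2 = disc by rewrite sqr_sqrtr.
have s0 : 0 <= s by rewrite sqrtr_ge0.
have ms : m - 3 < s.
  (* For [n = 3] the two squares agree, and strictness comes from [m - 3 < 0 <= s]. *)
  have [m3|m3] := ltrP m 3; first by lra.
  have pq4 : 4 <= p + q.
    by rewrite -natrD ler_nat; move: m3; rewrite /m -natrM ler_nat; nia.
  by rewrite -ltr_sqr ?nnegrE ?subr_ge0 // sE /disc /m; lra.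
pose t := (m - 1 + s) / 2.
have t0 : 0 < t by rewrite /t; lra.
have tm : m - 2 < t by rewrite /t; lra.
have tE : (Num.sqrt t) ^+ 2 = t by rewrite sqr_sqrtr // ltW.
have st0 : 0 < Num.sqrt t by rewrite sqrtr_gt0.
have t_rho : Num.sqrt t <= rho R G.
  apply: le_rho; apply: (bip_minus_edge_eigenvalue bG cS cT) => //.
    by rewrite gt_eqF.
  rewrite tE -/p -/q -/m /t; move: sE; rewrite /disc => sE.
  by field: sE.
have rho0 : 0 < rho R G by exact: lt_le_trans t_rho.
split=> //; rewrite natrM -/p -/q -/m; apply: lt_le_trans tm _.
by rewrite -tE ler_sqr // nnegrE ltW.
Qed.

Theorem corollary4p2 (R : realType) (n : nat) (G : sgraph)
    (a b : complete_bip (uphalf n) n./2) :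
  (3 <= n)%N ->
  #|G| = n ->
  triangle_free G ->
  sg_connected (sg_compl G) ->
  sedge a b ->
  rho R G <= rho R (del_edge a b) /\
  (rho R G = rho R (del_edge a b) <-> sg_iso G (del_edge a b)).
Proof.
move=> n3 cG tf conG ab.
have [T [v [w [bH cT]]]] := del_edge_bip ab.
have cH : #|del_edge a b| = n.
  rewrite card_sum !card_ord; have := odd_double_half n.
  have := uphalf_half n; lia.
have G0 : (0 < #|G|)%N by rewrite cG; lia.
have H0 : (0 < #|del_edge a b|)%N by rewrite cH; lia.
have iso_rho := @sg_iso_rho R _ _ G0 H0.
have [rH0 rH] := bip_minus_edge_rho R n3 cH bH cT.
have [eG _] := rhoP R G0.
have [u rG] := eigenvalue_sqr_le eG.
have [Du|[S [v' [w' [bG cS]]]]] := triangle_free_degree_sum u n3 cG tf conG.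
  suff lt_rho : rho R G < rho R (del_edge a b).
    split; first exact: ltW.
    by split=> [e|/iso_rho //]; move: lt_rho; rewrite e ltxx.
  (* Otherwise, with [m] the balanced product, the square of [rho R G] would be both greater than
     [m - 2] and at most [m - 2]. *)
  rewrite ltNge; apply/negP => le_rho.
  have : rho R (del_edge a b) ^+ 2 <= rho R G ^+ 2.
    have rG0 : 0 < rho R G by exact: lt_le_trans le_rho.
    by rewrite ler_sqr // nnegrE ltW.
  move: Du; rewrite -(ler_nat R) natrD; lra.
have iGH : sg_iso G (del_edge a b).
  by apply: bip_minus_edge_iso bG bH _ _; rewrite ?cS ?cT ?cG ?cH.
by rewrite (iso_rho iGH).
Qed.
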